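(* Let $R$ be a commutative noetherian ring. For a specialization closed subset $W$ of $\mathrm{Spec}(R)$ put $\mathcal{M}_W=\{M\in R\text{-}\mathrm{Mod}\mid \mathrm{Supp}_R(M)\subseteq W\}$ and $\Phi(W)=\mathcal{S}_{f.g.}*\mathcal{M}_W$. (1) $\Phi$ is a bijection from the set of specialization closed subsets of $\mathrm{Spec}(R)$ to the set of subcategories of the form $\mathcal{S}_{f.g.}*\mathcal{M}$, where $\mathcal{M}$ is a Serre subcategory of $R\text{-}\mathrm{Mod}$ closed under taking arbitrary direct sums. In other words, $\Phi$ gives an injective map from the set of specialization closed subsets of $\mathrm{Spec}(R)$ to the set of Serre subcategories of $R\text{-}\mathrm{Mod}$ containing $\mathcal{S}_{f.g.}$. (2) Suppose that $R$ has a unique minimal prime ideal $\mathfrak{p}$, and for a Serre subcategory $\mathcal{S}$ put $\Psi(\mathcal{S})=\mathbb{M}[\mathcal{S}]\setminus\{\mathfrak{p}\}$. Then the maps $\Phi$ and $\Psi$ give a one-to-one correspondence (mutually inverse bijections) between the set of specialization closed subsets $W$ of $\mathrm{Spec}(R)$ with $W\neq\mathrm{Spec}(R)$ and the set of subcategories of the form $\mathcal{S}_{f.g.}*\mathcal{M}$, where $\mathcal{M}$ is a Serre subcategory of $R\text{-}\mathrm{Mod}$ closed under taking arbitrary direct sums with $\mathcal{M}\neq R\text{-}\mathrm{Mod}$.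
   Context: All rings are commutative noetherian and all modules are unitary. $R\text{-}\mathrm{Mod}$ is the category of all $R$-modules; subcategories are full and closed under isomorphisms. A Serre subcategory of $R\text{-}\mathrm{Mod}$ is a (nonempty) subcategory closed under taking submodules, quotient modules and extensions. For an ideal $I$ of $R$ and an $R$-module $M$, $\Gamma_I(M)=\{x\in M \mid I^n x=0 \text{ for some } n\geq 1\}$ and $(0:_M I)=\{x\in M\mid Ix=0\}$. A Serre subcategory $\mathcal{S}$ satisfies the Melkersson condition $(C_I)$ if: for every $R$-module $M$, if $\Gamma_I(M)=M$ and $(0:_M I)\in\mathcal{S}$, then $M\in\mathcal{S}$. Put $\mathbb{M}[\mathcal{S}]=\{\mathfrak{p}\in\mathrm{Spec}(R)\mid \mathcal{S}\text{ satisfies }(C_{\mathfrak{p}})\}$. $\mathcal{S}_{f.g.}$ is the subcategory of finitely generated $R$-modules. For Serre subcategories $\mathcal{S}_1,\mathcal{S}_2$, $\mathcal{S}_1*\mathcal{S}_2$ is the subcategory of $R$-modules $M$ for which there is a short exact sequence $0\to S_1\to M\to S_2\to 0$ with $S_i\in\mathcal{S}_i$. It is known that $\mathcal{S}_{f.g.}*\mathcal{S}$ is a Serre subcategory for every Serre subcategory $\mathcal{S}$. A subset $W\subseteq\mathrm{Spec}(R)$ is specialization closed if $\mathfrak{p}\in W$ and $\mathfrak{p}\subseteq\mathfrak{p}'\in\mathrm{Spec}(R)$ imply $\mathfrak{p}'\in W$. *)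

(* Defs.v *)
From HB Require Import structures.
From mathcomp Require Import all_boot all_order all_algebra.
From mathcomp Require Import boolp classical_sets functions cardinality.

Set Implicit Arguments.
Unset Strict Implicit.
Unset Printing Implicit Defensive.

Import GRing.Theory.
Local Open Scope classical_set_scope.
Local Open Scope ring_scope.

(* Ideals are Prop-valued subsets and rings may be zero: [comPzRingType] rather
   than the boolean predicates over a nonzero ring of [ring_quotient]. *)

Section Ideals.
Variable R : comPzRingType.

Definition is_ideal (I : set R) : Prop :=
  [/\ I 0, forall a b, I a -> I b -> I (a + b) & forall a b, I b -> I (a * b)].

Definition fg_ideal (I : set R) : Prop :=
  exists (n : nat) (g : 'I_n -> R),
    I = [set x | exists c : 'I_n -> R, x = \sum_(i < n) c i * g i].

Definition noetherian : Prop := forall I : set R, is_ideal I -> fg_ideal I.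

Definition ideal_mul (I J : set R) : set R :=
  [set x | exists (n : nat) (a b : 'I_n -> R),
     (forall i, I (a i) /\ J (b i)) /\ x = \sum_(i < n) a i * b i].

Definition ideal_exp (I : set R) (n : nat) : set R := iter n (ideal_mul I) setT.

Definition is_prime (p : set R) : Prop :=
  [/\ is_ideal p, ~ p 1 & forall a b, p (a * b) -> p a \/ p b].

Definition Spec : set (set R) := [set p | is_prime p].

Definition minimal_prime (p : set R) : Prop :=
  Spec p /\ forall q, Spec q -> q `<=` p -> q = p.

Definition unique_minimal_prime (p : set R) : Prop :=
  minimal_prime p /\ forall q, minimal_prime q -> q = p.

Definition specialization_closed (W : set (set R)) : Prop :=
  W `<=` Spec /\ forall p q, W p -> Spec q -> p `<=` q -> W q.

End Ideals.

Arguments Spec : clear implicits.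
Arguments noetherian : clear implicits.

Section Annihilator.
Variables (R : comPzRingType) (I : set R) (M : lmodType R).

Definition ann_pred : {pred M} :=
  [pred x | `[< forall a, I a -> a *: x = 0 >]].

Lemma ann_pred_closed : submod_closed ann_pred.
Proof.
split=> [|a x y /asboolP xI /asboolP yI]; apply/asboolP => b Ib.
  by rewrite scaler0.
by rewrite scalerDr scalerA mulrC -scalerA xI// yI// scaler0 addr0.
Qed.

HB.instance Definition _ :=
  GRing.isSubmodClosed.Build R M ann_pred ann_pred_closed.

(* the submodule (0 :_M I), as a module in its own right *)
Record ann := Ann { ann_val : M; ann_valP : ann_val \in ann_pred }.

HB.instance Definition _ := [isSub for ann_val].
HB.instance Definition _ := [Choice of ann by <:].
HB.instance Definition _ := [SubChoice_isSubLmodule of ann by <:].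

End Annihilator.

Section Modules.
Variable R : comPzRingType.

Definition surjective_map (A B : Type) (f : A -> B) : Prop :=
  forall y, exists x, f x = y.

Definition short_exact (A B C : lmodType R)
    (f : {linear A -> B}) (g : {linear B -> C}) : Prop :=
  [/\ injective f, range f = g @^-1` [set 0] & surjective_map g].

Definition fg_module (M : lmodType R) : Prop :=
  exists (n : nat) (g : 'I_n -> M),
    forall x : M, exists c : 'I_n -> R, x = \sum_(i < n) c i *: g i.

Definition finite_support (I : Type) (F : I -> lmodType R)
    (f : forall i, F i) : Prop := finite_set [set i | f i <> 0].

(* M is the direct sum of the F i: x |-> (pi i x)_i is a bijection from M onto
   the families of finite support. *)
Definition is_direct_sum (I : Type) (F : I -> lmodType R) (M : lmodType R) :
    Prop :=
  exists pi : forall i, {linear M -> F i},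
    (forall x, finite_support (fun i => pi i x)) /\
    (forall f : forall i, F i, finite_support f ->
       exists! x : M, forall i, pi i x = f i).

(* Fractions x/s with s outside p are encoded as pairs (x, s); equality in
   the localization M_p. *)
Definition loc_eq (p : set R) (M : lmodType R) (u v : M * R) : Prop :=
  exists t, ~ p t /\ t *: (v.2 *: u.1 - u.2 *: v.1) = 0.

(* the primes p such that M_p <> 0 *)
Definition Supp (M : lmodType R) : set (set R) :=
  [set p | Spec R p /\
     exists (x : M) (s : R), ~ p s /\ ~ loc_eq p (x, s) (0, 1)].

Definition Gamma (I : set R) (M : lmodType R) : set M :=
  [set x | exists n, (1 <= n)%N /\ forall a, ideal_exp I n a -> a *: x = 0].

End Modules.

Arguments Gamma {R} I M _.

Section Bijections.
Variables (T U : Type) (A : T -> Prop) (B : U -> Prop).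

Definition maps_to (f : T -> U) : Prop := forall x, A x -> B (f x).

Definition inj_on (f : T -> U) : Prop :=
  forall x y, A x -> A y -> f x = f y -> x = y.

Definition bij_on (f : T -> U) : Prop :=
  [/\ maps_to f, inj_on f & forall y, B y -> exists2 x, A x & f x = y].

End Bijections.

Definition mutually_inverse (T U : Type) (A : T -> Prop) (B : U -> Prop)
    (f : T -> U) (g : U -> T) : Prop :=
  [/\ maps_to A B f, maps_to B A g,
      forall x, A x -> g (f x) = x & forall y, B y -> f (g y) = y].

Section Subcategories.
Variable R : comPzRingType.

(* Full subcategories of R-Mod, given by their objects.  This is not
   [set (lmodType R)], which the library's universe constraints forbid; for
   the same reason [bij_on] above is used instead of [set_bij]. *)
Definition subcat := lmodType R -> Prop.

Definition all_modules : subcat := fun=> True.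

Definition iso_closed (S : subcat) : Prop :=
  forall (M N : lmodType R) (f : {linear M -> N}), bijective f -> S M -> S N.

Definition serre (S : subcat) : Prop :=
  [/\ exists M, S M,
      iso_closed S,
      forall (N M : lmodType R) (f : {linear N -> M}),
        injective f -> S M -> S N,
      forall (M N : lmodType R) (f : {linear M -> N}),
        surjective_map f -> S M -> S N
    & forall (A B C : lmodType R) (f : {linear A -> B}) (g : {linear B -> C}),
        short_exact f g -> S A -> S C -> S B].

Definition direct_sum_closed (S : subcat) : Prop :=
  forall (I : Type) (F : I -> lmodType R) (M : lmodType R),
    is_direct_sum F M -> (forall i, S (F i)) -> S M.

Definition star (S1 S2 : subcat) : subcat := fun M =>
  exists (A B : lmodType R) (f : {linear A -> M}) (g : {linear M -> B}),
    [/\ short_exact f g, S1 A & S2 B].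

Definition melkersson (S : subcat) (I : set R) : Prop :=
  forall M : lmodType R, Gamma I M = setT -> S (ann I M) -> S M.

Definition melkersson_primes (S : subcat) : set (set R) :=
  [set p | Spec R p /\ melkersson S p].

Definition supported_in (W : set (set R)) : subcat := fun M => Supp M `<=` W.

Definition Phi (W : set (set R)) : subcat := star (@fg_module R) (supported_in W).

Definition Psi (p : set R) (S : subcat) : set (set R) :=
  melkersson_primes S `\ p.

Definition proper_specialization_closed (W : set (set R)) : Prop :=
  specialization_closed W /\ W <> Spec R.

Definition fg_star (S : subcat) : Prop :=
  exists M : subcat,
    [/\ serre M, direct_sum_closed M & S = star (@fg_module R) M].

Definition proper_fg_star (S : subcat) : Prop :=
  exists M : subcat,
    [/\ serre M, direct_sum_closed M, M <> all_modules
      & S = star (@fg_module R) M].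

Definition serre_containing_fg (S : subcat) : Prop :=
  serre S /\ forall M : lmodType R, fg_module M -> S M.

End Subcategories.

(* Main.v *)
(* A module lies in Phi(W) exactly when it has a finitely generated submodule
   whose quotient is supported in W.

   By noetherian induction on ideals, a Serre subcategory closed under direct
   sums contains R/I as soon as it contains R/p for every prime p above I, and
   every module is a quotient of the direct sum of its cyclic submodules; hence
   such subcategories are exactly the supported_in W.  The set W is recovered
   from Phi(W) because a direct sum of infinitely many copies of R/p lies in
   Phi(W) only if p lies in W.

   If q lies in W, every q-torsion module is supported in W, so (C_q) is trivial.
   Conversely let q be a non-minimal prime outside W, J maximal among the primes
   strictly below q, D = R/J and x in q but not in J.  The q-torsion part of
   D_x/D violates (C_q): its elements killed by q form a finitely generated
   module, but it contains s/x^n with s outside q for every n, whereas each of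
   its finitely generated submodules is killed by a power of x. *)

Require Import Defs.
From HB Require Import structures.
From mathcomp Require Import all_boot all_order all_algebra finmap.
From mathcomp Require Import boolp classical_sets functions cardinality fsbigop.

Set Implicit Arguments.
Unset Strict Implicit.
Unset Printing Implicit Defensive.

Import GRing.Theory.
Local Open Scope classical_set_scope.
Local Open Scope ring_scope.

(** * Submodules, quotients and linear maps *)

Section Submodules.
Variables (R : comPzRingType) (M : lmodType R).

(* On the regular module [R^o] this is convertible to [is_ideal]. *)
Definition is_submodule (N : set M) : Prop :=
  [/\ N 0, forall x y, N x -> N y -> N (x + y) & forall a x, N x -> N (a *: x)].

Record submodule :=
  Submodule { elements : set M; elementsP : is_submodule elements }.

Definition submodule_pred (N : submodule) : {pred M} :=
  [pred x | `[< elements N x >]].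

Lemma submodule_pred_closed N : submod_closed (submodule_pred N).
Proof.
have [N0 ND NZ] := elementsP N; split=> [|a x y /asboolP Nx /asboolP Ny].
  exact/asboolP.
by apply/asboolP; apply: ND => //; apply: NZ.
Qed.

HB.instance Definition _ N :=
  GRing.isSubmodClosed.Build R M (submodule_pred N) (submodule_pred_closed N).

Record submodule_type (N : submodule) :=
  SubmoduleType { submodule_val : M; _ : submodule_val \in submodule_pred N }.

HB.instance Definition _ N := [isSub for @submodule_val N].
HB.instance Definition _ N := [Choice of submodule_type N by <:].
HB.instance Definition _ N :=
  [SubChoice_isSubLmodule of submodule_type N by <:].

Lemma submodule_valP (N : submodule) (x : submodule_type N) :
  elements N (\val x).
Proof. by case: x => x /= /asboolP. Qed.

Definition submodule_elt (N : submodule) (x : M) (Nx : elements N x) :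
  submodule_type N := SubmoduleType (asboolT Nx : x \in submodule_pred N).

End Submodules.

Section Quotients.
Variables (R : comPzRingType) (M : lmodType R) (N : submodule M).

Definition quotient : Type := Quotient.quot (submodule_pred N).
HB.instance Definition _ := GRing.Zmodule.on quotient.

Definition proj (x : M) : quotient := (\pi_(Quotient.quot (submodule_pred N)) x)%qT.

Lemma proj_eqP x y : proj x = proj y <-> elements N (x - y).
Proof.
split=> [e|e].
  by have /eqP := e; rewrite -Quotient.idealrBE => /asboolP.
by apply/eqP; rewrite -Quotient.idealrBE; apply/asboolP.
Qed.

Lemma proj_repr (u : quotient) : proj (repr u) = u.
Proof. exact: reprK. Qed.

Definition quotient_scale (a : R) (u : quotient) : quotient :=
  proj (a *: repr u).

Lemma proj_scale a x : quotient_scale a (proj x) = proj (a *: x).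
Proof.
apply/proj_eqP; rewrite -scalerBr.
have [_ _ NZ] := elementsP N; apply/NZ/proj_eqP; exact: proj_repr.
Qed.

Lemma projD x y : proj (x + y) = proj x + proj y.
Proof. by rewrite /proj raddfD. Qed.

Fact quotient_scaleA a b u :
  quotient_scale a (quotient_scale b u) = quotient_scale (a * b) u.
Proof. by rewrite -[u]proj_repr !proj_scale scalerA. Qed.

Fact quotient_scale1 : left_id 1 quotient_scale.
Proof. by move=> u; rewrite -[u]proj_repr !proj_scale scale1r. Qed.

Fact quotient_scaleDr : right_distributive quotient_scale +%R.
Proof.
by move=> a u v; rewrite -[u]proj_repr -[v]proj_repr -projD !proj_scale -projD scalerDr.
Qed.

Fact quotient_scaleDl u : {morph quotient_scale^~ u : a b / a + b}.
Proof. by move=> a b; rewrite -[u]proj_repr !proj_scale -projD scalerDl. Qed.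

HB.instance Definition _ := GRing.Zmodule_isLmodule.Build R quotient
  quotient_scaleA quotient_scale1 quotient_scaleDr quotient_scaleDl.

Fact proj_linear : linear proj.
Proof. by move=> a x y; rewrite projD -proj_scale. Qed.

HB.instance Definition _ :=
  GRing.isLinear.Build R M quotient _ proj proj_linear.

End Quotients.

(** * Linear maps, submodules and quotients as existence statements *)

Section Existence.
Variable R : comPzRingType.

Lemma exists_linear (M N : lmodType R) (f : M -> N) : linear f ->
  exists h : {linear M -> N}, h =1 f.
Proof.
move=> lin; pose H := GRing.isLinear.Build R M N _ f lin.
by pose h : {linear M -> N} := HB.pack f H; exists h.
Qed.

Lemma exists_scale (M : lmodType R) (x : M) :
  exists h : {linear R^o -> M}, forall r, h r = r *: x.
Proof.
by apply: (@exists_linear R^o M) => a r s; rewrite scalerDl scalerA.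
Qed.

(** Compose [g] with a set-theoretic section of [f]; since [g] kills the kernel of [f], the choice
    of section does not matter, which makes the composite linear. *)
Lemma linear_factor (M B C : lmodType R) (f : {linear M -> B}) (g : {linear M -> C}) :
    surjective_map f -> (forall x, f x = 0 -> g x = 0) ->
  exists h : {linear B -> C}, forall x, h (f x) = g x.
Proof.
move=> surjf fg; have [s sK] := choice surjf.
have gs x : g (s (f x)) = g x.
  by apply/subr0_eq; rewrite -linearB; apply: fg; rewrite linearB sK subrr.
have [|h hE] := @exists_linear B C (g \o s).
  move=> a u v /=; rewrite -linearP -[LHS]gs -[RHS]gs; congr (g (s _)).
  by rewrite !(linearP, sK).
by exists h => x; rewrite hE /= gs.
Qed.

Lemma exists_submodule (M : lmodType R) (N : set M) : is_submodule N ->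
  exists (A : lmodType R) (f : {linear A -> M}), injective f /\ range f = N.
Proof.
move=> subN; pose S := Submodule subN.
exists (submodule_type S), (\val : {linear submodule_type S -> M}).
split; first exact: val_inj.
apply/seteqP; split=> [_ [x _ <-]|x Nx]; first exact: (submodule_valP x).
by exists (@submodule_elt _ _ S x Nx).
Qed.

Lemma exists_quotient (M : lmodType R) (N : set M) : is_submodule N ->
  exists (Q : lmodType R) (f : {linear M -> Q}),
    surjective_map f /\ forall x, f x = 0 <-> N x.
Proof.
move=> subN; pose S := Submodule subN.
exists (quotient S), (@proj _ _ S : {linear M -> quotient S}); split=> [u|x].
  by exists (repr u); apply: proj_repr.
by rewrite -[X in _ = X](raddf0 (@proj _ _ S)) proj_eqP subr0.
Qed.

(** The module [N / (N \cap N0)], by which test modules are cut out of modules of sequences. *)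
Lemma exists_subquotient (M : lmodType R) (N N0 : set M) :
    is_submodule N -> is_submodule N0 ->
  exists (A Q : lmodType R) (f : {linear A -> M}) (h : {linear A -> Q}),
    [/\ injective f, range f = N, surjective_map h
      & forall a, h a = 0 <-> N0 (f a)].
Proof.
move=> /exists_submodule[A [f [injf fA]]] [N00 N0D N0Z].
have subA : is_submodule (f @^-1` N0).
  split=> [|x y ? ?|a x ?]; rewrite /preimage /=.
  - by rewrite linear0.
  - by rewrite linearD; apply: N0D.
  - by rewrite linearZ; apply: N0Z.
by have [Q [h [surjh hQ]]] := exists_quotient subA; exists A, Q, f, h.
Qed.

End Existence.

(** * Ideals of a noetherian ring *)

Section Ideals.
Variable R : comPzRingType.
Implicit Types (I J K p q : set R) (a s x : R).

(** The ideal [I + Ra]. *)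
Definition adjoin I a : set R := [set r | exists i c, I i /\ r = i + c * a].

(** The colon ideal [(I : a)]. *)
Definition colon I a : set R := [set r | I (r * a)].

Lemma is_ideal_adjoin I a : is_ideal I -> is_ideal (adjoin I a).
Proof.
case=> I0 ID IM; split.
- by exists 0, 0; rewrite mul0r addr0.
- move=> _ _ [i [c [Ii ->]]] [j [d [Ij ->]]].
  by exists (i + j), (c + d); split; [exact: ID | rewrite mulrDl addrACA].
- move=> b _ [i [c [Ii ->]]].
  by exists (b * i), (b * c); split; [exact: IM | rewrite mulrDr mulrA].
Qed.

Lemma is_ideal_colon I a : is_ideal I -> is_ideal (colon I a).
Proof.
case=> I0 ID IM; split; rewrite /colon /=.
- by rewrite mul0r.
- by move=> x y Ix Iy; rewrite mulrDl; apply: ID.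
- by move=> x y Iy; rewrite -mulrA; apply: IM.
Qed.

Lemma sub_adjoin I a : I `<=` adjoin I a.
Proof. by move=> x Ix; exists x, 0; rewrite mul0r addr0. Qed.

Lemma mem_adjoin I a : is_ideal I -> adjoin I a a.
Proof. by case=> I0 _ _; exists 0, 1; rewrite mul1r add0r. Qed.

Lemma sub_colon I a : is_ideal I -> I `<=` colon I a.
Proof. by case=> _ _ IM x Ix; rewrite /colon /= mulrC; apply: IM. Qed.

Lemma mem_generator I n (g : 'I_n -> R) i :
  I = [set x | exists c : 'I_n -> R, x = \sum_(i < n) c i * g i] -> I (g i).
Proof.
move=> ->; exists (fun j => (j == i)%:R).
by rewrite (bigD1 i) //= eqxx mul1r big1 ?addr0 // => j /negPf->; rewrite mul0r.
Qed.

Lemma ideal_sum I n (f : 'I_n -> R) :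
  is_ideal I -> (forall i, I (f i)) -> I (\sum_(i < n) f i).
Proof. by case=> I0 ID _ If; apply: big_ind. Qed.

Lemma prime_ideal p : Spec R p -> is_ideal p. Proof. by case. Qed.

Lemma prime_notM p a b : Spec R p -> ~ p a -> ~ p b -> ~ p (a * b).
Proof. by case=> _ _ pM pa pb /pM[]. Qed.

Lemma prime_exp p a n : Spec R p -> p (a ^+ n) -> p a.
Proof.
move=> /[dup] pp [_ p1 pM]; elim: n => [|n IHn]; first by rewrite expr0.
by rewrite exprS => /pM[//|/IHn].
Qed.

(** Zorn's lemma for reverse inclusion on the primes inside [q]: the intersection of a nonempty
    chain of primes is prime. *)
Lemma exists_minimal_prime q : Spec R q ->
  exists2 p, minimal_prime p & p `<=` q.
Proof.
move=> Sq; pose T := {p | Spec R p /\ p `<=` q}.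
pose r (s t : T) : bool := `[< sval t `<=` sval s >].
have [||||[p [Sp pq]] pmin] := @Zorn T r.
- by move=> t; apply/asboolP.
- by move=> t s u /asboolP ts /asboolP su; apply/asboolP/(subset_trans su).
- move=> [s Ps] [t Pt] /asboolP/= ts /asboolP/= st.
  by apply: eq_exist; rewrite eqEsubset.
- move=> A totA; have [[t0 At0]|A0] := pselect (exists t, A t); last first.
    by exists (exist _ q (conj Sq (@subset_refl _ q))) => s As; case: A0; exists s.
  pose m := \bigcap_(t in A) sval t.
  have tI (t : T) : is_ideal (sval t) by exact: (prime_ideal (svalP t).1).
  have Sm : Spec R m.
    split.
    - split=> [t At|a b ma mb t At|a b mb t At]; have [t1 t2 t3] := tI t => //.
        by apply: t2; [apply: ma | apply: mb].
      by apply: t3; apply: mb.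
    - by move=> m1; have [[_ + _] _] := svalP t0; apply; apply: m1.
    (* If one member of the chain misses [a] and another misses [b], the smaller one misses both,
       although it contains [a * b]. *)
    - move=> a b mab; apply: contrapT => /not_orP[].
      move=> /existsNP[s /not_implyP[As sa]] /existsNP[t /not_implyP[At tb]].
      have tP (u : T) : A u -> sval u a \/ sval u b.
        by move=> Au; have [[_ _ uM] _] := svalP u; apply/uM/(mab _ Au).
      have [/asboolP ts|/asboolP st] := totA s t As At.
        by have [/ts|] := tP t At.
      by have [|/st] := tP s As.
  have mq : m `<=` q by move=> x mx; apply: (svalP t0).2; apply: mx.
  exists (exist _ m (conj Sm mq)) => s As; apply/asboolP => x mx; exact: mx.
exists p => //; split=> // s Ss sp.
have rs : r (exist _ p (conj Sp pq)) (exist _ s (conj Ss (subset_trans sp pq))).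
  exact/asboolP.
by have := pmin _ rs => /(congr1 sval).
Qed.

Lemma unique_minimal_prime_sub p q :
  unique_minimal_prime p -> Spec R q -> p `<=` q.
Proof. by move=> [_ pu] /exists_minimal_prime[p' /pu ->]. Qed.

Lemma ideal_exp_expr I n a : I a -> ideal_exp I n (a ^+ n).
Proof.
move=> Ia; elim: n => [//|n IHn]; rewrite exprS /ideal_exp iterS.
by exists 1%N, (fun=> a), (fun=> a ^+ n); split=> //; rewrite big_ord1.
Qed.

(** [I^n] is generated by the products of [n] elements of [I], so these suffice as tests. The
    multiplier [s] collects the factors already split off in the induction on [n]. *)
Lemma ideal_exp_ind (P : set R) I n s : is_ideal P ->
    (forall l : seq R, size l = n -> (forall a, a \in l -> I a) ->
       P (s * \prod_(a <- l) a)) ->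
  forall a, ideal_exp I n a -> P (s * a).
Proof.
move=> idP; elim: n s => [|n IHn] s Ps a.
  move=> _; case: idP => _ _ PM; rewrite mulrC; apply: PM.
  by have := Ps [::] erefl; rewrite big_nil mulr1; apply.
rewrite /ideal_exp iterS => -[m [u [v [uv ->]]]]; rewrite mulr_sumr.
apply: ideal_sum => // i; have [Iu Iv] := uv i; rewrite mulrA.
apply: IHn => // l ln lI; have := Ps (u i :: l); rewrite big_cons mulrA; apply.
  by rewrite /= ln.
by move=> b; rewrite inE => /orP[/eqP->//|]; apply: lI.
Qed.

Section Noetherian.
Hypothesis noethR : noetherian R.

(** Otherwise dependent choice gives a strictly increasing chain in [P]; the finitely many
    generators of its union already lie in one term, where the chain must stop. *)
Lemma noetherian_max (P : set (set R)) I0 :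
    (forall I, P I -> is_ideal I) -> P I0 ->
  exists2 I, P I & forall J, P J -> I `<=` J -> J = I.
Proof.
move=> Pid PI0; apply: contrapT => nomax.
have next (I : {I | P I}) : exists J : {I | P I},
    sval I `<=` sval J /\ sval J <> sval I.
  case: I => I PI; apply: contrapT => noJ; apply: nomax; exists I => // J PJ IJ.
  by apply: contrapT => JI; apply: noJ; exists (exist _ J PJ).
have [nx nxP] := choice next.
pose c n := iter n nx (exist _ I0 PI0).
have cid n : is_ideal (sval (c n)) by apply: Pid; exact: (svalP (c n)).
have cle m n : (m <= n)%N -> sval (c m) `<=` sval (c n).
  elim: n => [|n IHn]; first by rewrite leqn0 => /eqP->.
  rewrite leq_eqVlt => /orP[/eqP->//|/IHn cmn].
  by apply: subset_trans cmn _; rewrite /c iterS; exact: (nxP _).1.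
pose U := \bigcup_n sval (c n).
have UI : is_ideal U.
  split.
  - by exists 0%N => //; case: (cid 0%N).
  - move=> a b [m _ ca] [n _ cb]; exists (maxn m n) => //.
    by case: (cid (maxn m n)) => _ + _; apply;
      [apply: cle ca; apply: leq_maxl | apply: cle cb; apply: leq_maxr].
  - by move=> a b [n _ cb]; exists n => //; case: (cid n) => _ _; apply.
have [k [g Ug]] := noethR UI.
have gU i : exists n, sval (c n) (g i).
  by have [n _ gn] := mem_generator i Ug; exists n.
have [f fP] := choice gU; pose N := \max_(i < k) f i.
have UN : U `<=` sval (c N).
  rewrite Ug => _ [d ->]; apply: ideal_sum => // i.
  case: (cid N) => _ _; apply; apply: cle (fP i).
  exact: (@leq_bigmax_cond _ _ f).
have [cN neq] := nxP (c N); apply: neq; rewrite eqEsubset; split=> // x cx.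
by apply: UN; exists N.+1.
Qed.

(** An ideal maximal among counterexamples is proper and not prime, so it contains some [a * b] but
    neither factor; then [I + Ra] and [(I : a)], which contains [b], are strictly larger. *)
Lemma ideal_ind (P : set R -> Prop) :
    P setT -> (forall p, Spec R p -> P p) ->
    (forall I a, is_ideal I -> P (adjoin I a) -> P (colon I a) -> P I) ->
  forall I, is_ideal I -> P I.
Proof.
move=> PT Pprime Pstep I0 idI0; apply: contrapT => nP.
have [I [idI nPI] maxI] :=
  @noetherian_max [set I | is_ideal I /\ ~ P I] I0 (fun _ => @proj1 _ _)
    (conj idI0 nP).
have [I1|nI1] := pselect (I 1).
  suff IT : I = setT by apply: nPI; rewrite IT.
  rewrite eqEsubset; split=> // x _; case: idI => _ _ /(_ x 1 I1).
  by rewrite mulr1.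
have [|nprime] := pselect (Spec R I); first by move=> /Pprime.
have [a [b [Iab nIa nIb]]] : exists a b, [/\ I (a * b), ~ I a & ~ I b].
  apply: contrapT => noab; apply: nprime; split=> // a b Iab.
  by apply: contrapT => /not_orP[nIa nIb]; apply: noab; exists a, b.
apply/nPI/(Pstep I a) => //; apply: contrapT => nPJ.
- have := maxI (adjoin I a) (conj (is_ideal_adjoin a idI) nPJ) (@sub_adjoin I a).
  by move=> E; apply: nIa; rewrite -E; apply: mem_adjoin.
- have := maxI (colon I a) (conj (is_ideal_colon a idI) nPJ) (sub_colon a idI).
  by move=> E; apply: nIb; rewrite -E /colon /= mulrC.
Qed.

(* [q] is minimal over [I], so [q R_q] is nilpotent modulo [I R_q]. *)
Lemma minimal_over_nilpotent q I : Spec R q -> is_ideal I ->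
    (forall p, Spec R p -> I `<=` p -> p `<=` q -> p = q) ->
  exists k s, ~ q s /\ forall l : seq R,
    size l = k -> (forall a, a \in l -> q a) -> I (s * \prod_(a <- l) a).
Proof.
move=> Sq idI Imin; move: I idI Imin.
apply: ideal_ind => [_|p Sp pmin|I a idI IHa IHc Imin].
- by exists 0%N, 1; split=> //; case: Sq.
(* If [p] lies in [q], the two are equal and one factor from [q] suffices; otherwise an [s] in [p]
   outside [q] needs no factor at all. *)
- have [pq|/existsNP[s /not_implyP[ps qs]]] := pselect (p `<=` q).
    rewrite (pmin p) //; exists 1%N, 1; split; first by case: Sq.
    case=> [//|a [|//]] _ qa; rewrite big_seq1 mul1r; apply: qa.
    by rewrite inE.
  exists 0%N, s; split=> // l _ _; rewrite mulrC.
  by case: (prime_ideal Sp) => _ _; apply.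
have [p Sp Ip pq|k [s [qs sI]]] := IHa.
  by apply: Imin => //; apply: subset_trans Ip; apply: sub_adjoin.
have [p Sp Ip pq|k' [s' [qs' sI']]] := IHc.
  by apply: Imin => //; apply: subset_trans Ip; apply: sub_colon.
(* The first [k] factors with [s] give [i + c * a] with [i] in [I]; the other factors with [s'] give
   an element that [a] carries into [I]. *)
exists (k + k')%N, (s * s'); split; first exact: prime_notM.
move=> l sl ql; rewrite -[l](cat_take_drop k) big_cat /= mulrACA.
have [|b /mem_take/ql //|i [c [Ii ->]]] := sI (take k l).
  by rewrite size_takel // sl leq_addr.
have {sI'} : colon I a (s' * \prod_(b <- drop k l) b).
  by apply: sI' => [|b /mem_drop/ql //]; rewrite size_drop sl addKn.
rewrite /colon /=; case: idI => _ ID IM; set d := s' * _ => Id.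
rewrite mulrDl; apply: ID; first by rewrite mulrC; apply: IM.
by rewrite -mulrA (mulrC a); apply: IM.
Qed.

End Noetherian.
End Ideals.

(** * Finitely generated submodules *)

Section Spans.
Variables (R : comPzRingType) (M : lmodType R).
Implicit Types (N : set M).

Definition lspan n (g : 'I_n -> M) : set M :=
  [set x | exists c : 'I_n -> R, x = \sum_(i < n) c i *: g i].

Lemma is_submodule_lspan n (g : 'I_n -> M) : is_submodule (lspan g).
Proof.
split.
- by exists (fun=> 0); rewrite big1 // => i _; rewrite scale0r.
- move=> _ _ [c ->] [d ->]; exists (fun i => c i + d i).
  by rewrite -big_split /=; apply: eq_bigr => i _; rewrite scalerDl.
- move=> a _ [c ->]; exists (fun i => a * c i).
  by rewrite scaler_sumr; apply: eq_bigr => i _; rewrite scalerA.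
Qed.

Lemma submoduleB N x y : is_submodule N -> N x -> N y -> N (x - y).
Proof. by case=> _ ND NZ Nx Ny; rewrite -scaleN1r; apply/ND/NZ. Qed.

Lemma mem_lspan n (g : 'I_n -> M) i : lspan g (g i).
Proof.
exists (fun j => (j == i)%:R); rewrite (bigD1 i) //= eqxx scale1r big1 ?addr0 //.
by move=> j /negPf->; rewrite scale0r.
Qed.

Lemma lspan_sub N n (g : 'I_n -> M) :
  is_submodule N -> (forall i, N (g i)) -> lspan g `<=` N.
Proof.
by case=> N0 ND NZ Ng _ [c ->]; apply: big_ind => // i _; apply: NZ.
Qed.

Lemma lspan_union n m (g : 'I_n -> M) (h : 'I_m -> M) :
  exists k (u : 'I_k -> M), [/\ forall i, lspan u (g i), forall j, lspan u (h j) &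
    forall N, (forall i, N (g i)) -> (forall j, N (h j)) -> forall i, N (u i)].
Proof.
pose u (i : 'I_(n + m)) := match fintype.split i with inl j => g j | inr j => h j end.
exists (n + m)%N, u; split.
- move=> i; have -> : g i = u (lshift m i) by rewrite /u (unsplitK (inl i)).
  exact: mem_lspan.
- move=> j; have -> : h j = u (rshift n j) by rewrite /u (unsplitK (inr j)).
  exact: mem_lspan.
- by move=> N Ng Nh i; rewrite /u; case: (fintype.split i).
Qed.

(* Induction on [n]: the coefficients of [g ord0] in the elements of [N] form
   an ideal, and the elements of [N] lifting its generators generate [N] modulo
   the span of the other [g i]. *)
Lemma noetherian_submodule n (g : 'I_n -> M) N : noetherian R ->
  is_submodule N -> N `<=` lspan g -> exists m (u : 'I_m -> M), N = lspan u.
Proof.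
move=> noethR; elim: n => [|n IHn] in g N *; move=> /[dup] subN [N0 ND NZ] Ng.
  exists 0%N, g; rewrite eqEsubset; split=> // _ [c ->].
  by rewrite big_ord0.
pose h i := g (lift ord0 i).
have gE x : lspan g x <-> exists a y, lspan h y /\ x = a *: g ord0 + y.
  split=> [[c ->]|[a [_ [[c ->] ->]]]].
    rewrite big_ord_recl; exists (c ord0), (\sum_(i < n) c (lift ord0 i) *: h i).
    by split=> //; exists (fun i => c (lift ord0 i)).
  have [_ sD sZ] := is_submodule_lspan g.
  apply: sD; first exact/sZ/mem_lspan.
  apply: (lspan_sub (is_submodule_lspan g)); last by exists c.
  by move=> i; apply: mem_lspan.
have [h0 hD hZ] := is_submodule_lspan h.
pose I : set R := [set a | exists y, lspan h y /\ N (a *: g ord0 + y)].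
have /noethR[k [a Ia]] : is_ideal I.
  split.
  - by exists 0; rewrite scale0r addr0.
  - move=> b c [y [hy Ny]] [z [hz Nz]]; exists (y + z); split; first exact: hD.
    by rewrite scalerDl addrACA; apply: ND.
  - move=> b c [y [hy Ny]]; exists (b *: y); split; first exact: hZ.
    by rewrite -scalerA -scalerDr; apply: NZ.
have [y yP] := choice (fun i => mem_generator i Ia : I (a i)).
have subNh : is_submodule (N `&` lspan h).
  split=> [|u v [? ?] [? ?]|b u [? ?]]; split;
    by [|apply: ND|apply: hD|apply: NZ|apply: hZ].
have [|m [u Nu]] := IHn h _ subNh; first by move=> ? [].
have uN i : N (u i) by have [] : (N `&` lspan h) (u i) by rewrite Nu; apply: mem_lspan.
have [l [v [vy vu vN]]] := lspan_union (fun i => a i *: g ord0 + y i) u.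
exists l, v; rewrite eqEsubset; split; last first.
  by apply: lspan_sub => // i; apply: vN => // j; case: (yP j).
move=> x Nx; have /gE[b [z [hz xE]]] := Ng _ Nx.
have : I b by exists z; rewrite -xE.
rewrite Ia => -[c bE]; pose w := \sum_(i < k) c i *: (a i *: g ord0 + y i).
have wv : lspan v w by apply: (lspan_sub (is_submodule_lspan v) vy); exists c.
have wN : N w.
  have yN i : N (a i *: g ord0 + y i) by case: (yP i).
  by apply: (lspan_sub subN yN); exists c.
suff : lspan v (x - w).
  by have [_ vD _] := is_submodule_lspan v => /vD/(_ wv); rewrite subrK.
(* The coefficients of [g ord0] in [x] and [w] agree, so [x - w] lies in [N] and in the span of [h];
   the intersection of these is generated by [u]. *)
apply: (lspan_sub (is_submodule_lspan v) vu); rewrite -Nu; split.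
  exact: submoduleB.
have -> : x - w = z - \sum_(i < k) c i *: y i.
  rewrite xE /w bE scaler_suml.
  under [X in _ - X]eq_bigr => i _ do rewrite scalerDr scalerA.
  by rewrite big_split /= opprD addrACA subrr add0r.
apply: (submoduleB (is_submodule_lspan h) hz).
have hy i : lspan h (y i) by case: (yP i).
by apply: (lspan_sub (is_submodule_lspan h) hy); exists c.
Qed.

End Spans.

Lemma linear_lspan (R : comPzRingType) (M N : lmodType R) (f : {linear M -> N})
  n (g : 'I_n -> M) x : lspan g x -> lspan (f \o g) (f x).
Proof.
case=> c ->; exists c; rewrite linear_sum.
by apply: eq_bigr => i _; rewrite linearZ.
Qed.

(** * Supports *)

Section Support.
Variable R : comPzRingType.
Implicit Types (p q : set R) (W : set (set R)) (M N : lmodType R).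

(** A fraction [x / s] is zero exactly when some element outside [p] kills [x], so the denominator
    can be taken to be 1. *)
Lemma SuppP M p :
  Supp M p <-> Spec R p /\ exists x : M, forall r, r *: x = 0 -> p r.
Proof.
split=> -[Sp].
  move=> [x [s [ps nloc]]]; split=> //; exists x => r rx.
  apply: contrapT => pr; apply: nloc; exists r.
  by rewrite /= scaler0 subr0 scale1r.
case=> x xp; split=> //; exists x, 1; case: (Sp) => _ p1 _; split=> //.
by move=> -[t [pt]]; rewrite /= scaler0 subr0 scale1r => /xp.
Qed.

(** Elementwise form of [M_p = 0] for the primes [p] outside [W]: each fraction [x / 1] vanishes. *)
Lemma supported_inP W M : supported_in W M <->
  forall p, Spec R p -> ~ W p -> forall x : M, exists2 r, ~ p r & r *: x = 0.
Proof.
split=> [MW p Sp Wp x|MW p /SuppP[Sp [x xp]]].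
  apply: contrapT => nr; apply/Wp/MW/SuppP; split=> //; exists x => r rx.
  by apply: contrapT => pr; apply: nr; exists r.
by apply: contrapT => Wp; have [r pr /xp] := MW p Sp Wp x.
Qed.

Lemma supported_in_serre W : serre (@supported_in R W).
Proof.
have sub (N M : lmodType R) (f : {linear N -> M}) :
    injective f -> supported_in W M -> supported_in W N.
  move=> injf /supported_inP MW; apply/supported_inP => p Sp Wp x.
  have [r pr rx] := MW p Sp Wp (f x); exists r => //; apply: injf.
  by rewrite linearZ /= rx linear0.
have quo (M N : lmodType R) (f : {linear M -> N}) :
    surjective_map f -> supported_in W M -> supported_in W N.
  move=> surjf /supported_inP MW; apply/supported_inP => p Sp Wp y.
  have [x <-] := surjf y; have [r pr rx] := MW p Sp Wp x; exists r => //.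
  by rewrite -linearZ rx linear0.
split=> //.
- exists 'rV[R]_0; apply/supported_inP => p [_ p1 _] _ x; exists 1 => //.
  by apply/rowP => -[].
- move=> M N f [h hK fK]; apply: (quo _ _ f) => y; exists (h y); exact: fK.
- move=> A B C f g [injf fg surjg] /supported_inP AW /supported_inP CW.
  apply/supported_inP => p Sp Wp x.
  have [r pr rx] := CW p Sp Wp (g x).
  have [a _ fa] : range f (r *: x) by rewrite fg /= linearZ.
  have [s ps sa] := AW p Sp Wp a; exists (s * r); first exact: prime_notM.
  by rewrite -scalerA -fa -linearZ sa linear0.
Qed.

Lemma supported_in_direct_sum_closed W : direct_sum_closed (@supported_in R W).
Proof.
move=> I F M [pi [pifin piP]] FW; apply/supported_inP => p Sp Wp x.
have [A Ax] : exists A : {fset {classic I}}, [set i | pi i x <> 0] = [set` A].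
  by have /finite_fsetP := pifin x : finite_set ([set i | _] : set {classic I}).
have /choice[r rP] : forall i : {classic I}, exists s, ~ p s /\ s *: pi i x = 0.
  by move=> i; have /supported_inP/(_ p Sp Wp (pi i x))[s] := FW i; exists s.
(* The support of [x] is finite, so the multipliers killing its components can be multiplied
   together; primality keeps the product outside [p]. *)
pose s := \prod_(i <- A) r i; exists s.
  apply: (big_ind (fun t => ~ p t)); first by case: Sp.
    by move=> a b; apply: prime_notM.
  by move=> i _; case: (rP i).
have sx i : pi i (s *: x) = 0.
  rewrite linearZ /=; have [->|xi] := pselect (pi i x = 0); first by rewrite scaler0.
  have iA : (i : {classic I}) \in A by have : [set` A] i by rewrite -Ax.
  rewrite /s (big_fsetD1 (i : {classic I})) //= mulrC -scalerA.
  by rewrite (rP i).2 scaler0.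
(* Uniqueness for the zero family shows that an element with zero components is zero. *)
have fin0 : Defs.finite_support (fun i => 0 : F i).
  by rewrite /Defs.finite_support [X in finite_set X](_ : _ = set0) // -subset0.
have [z [_ zu]] := piP _ fin0.
by rewrite -(zu (s *: x)) // (zu 0) // => i; rewrite linear0.
Qed.

(** The span of [g] is the submodule of the extension; its quotient localizes to zero off [W]. *)
Lemma PhiP W M : Phi W M <-> exists n (g : 'I_n -> M),
  forall p, Spec R p -> ~ W p -> forall x : M, exists2 r, ~ p r & lspan g (r *: x).
Proof.
split=> [[A [B [f [h [[injf fh surjh] [n [g gA]] /supported_inP BW]]]]]|].
  exists n, (f \o g) => p Sp Wp x; have [r pr rx] := BW p Sp Wp (h x).
  exists r => //; have [a _ <-] : range f (r *: x) by rewrite fh /= linearZ.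
  by apply: linear_lspan; have [c] := gA a; exists c.
case=> n [g gP].
have [A [f [injf fA]]] := exists_submodule (is_submodule_lspan g).
have [B [h [surjh hB]]] := exists_quotient (is_submodule_lspan g).
exists A, B, f, h; split.
- by split=> //; rewrite fA; apply/seteqP; split=> x /hB.
- have : forall i, exists a, f a = g i.
    move=> i; have : range f (g i) by rewrite fA; apply: mem_lspan.
    by case=> a _; exists a.
  move=> /choice[a aP]; exists n, a => x.
  have [c xE] : lspan g (f x) by rewrite -fA; exists x.
  exists c; apply: injf; rewrite xE linear_sum.
  by apply: eq_bigr => i _; rewrite linearZ aP.
- apply/supported_inP => p Sp Wp y; have [x <-] := surjh y.
  by have [r pr /hB rx] := gP p Sp Wp x; exists r => //; rewrite -linearZ.
Qed.

Lemma Phi_fg W M : fg_module M -> Phi W M.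
Proof.
case=> n [g gM]; apply/PhiP; exists n, g => p [_ p1 _] _ x; exists 1.
  exact: p1.
exact: gM.
Qed.

Lemma Phi_supported_in W M : supported_in W M -> Phi W M.
Proof.
move=> /supported_inP MW; apply/PhiP; exists 0%N, (fun=> 0) => p Sp Wp x.
have [r pr rx] := MW p Sp Wp x; exists r => //; rewrite rx.
by case: (is_submodule_lspan (fun _ : 'I_0 => 0 : M)).
Qed.

(** For a submodule, the trace of the span of [g] on it is finitely generated because [R] is
    noetherian; for an extension, join generators coming from [A] with lifts of those of [C]. *)
Lemma Phi_serre W : noetherian R -> serre (@Phi R W).
Proof.
move=> noethR.
have quo (M N : lmodType R) (f : {linear M -> N}) :
    surjective_map f -> Phi W M -> Phi W N.
  move=> surjf /PhiP[n [g gP]]; apply/PhiP; exists n, (f \o g) => p Sp Wp y.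
  have [x <-] := surjf y; have [r pr rx] := gP p Sp Wp x; exists r => //.
  by rewrite -linearZ; apply: linear_lspan.
split=> //.
- have [[M MW] _ _ _ _] := supported_in_serre W.
  by exists M; apply: Phi_supported_in.
- move=> M N f [h hK fK]; apply: (quo _ _ f) => y; exists (h y); exact: fK.
- move=> N M f injf /PhiP[n [g gP]].
  have [gs0 gD gZ] := is_submodule_lspan g.
  have subfg : is_submodule (range f `&` lspan g).
    split=> [|_ _ [[x _ <-] ?] [[y _ <-] ?]|a _ [[x _ <-] ?]].
    - by split=> //; exists 0 => //; rewrite linear0.
    - by split; [exists (x + y) => //; rewrite linearD | apply: gD].
    - by split; [exists (a *: x) => //; rewrite linearZ | apply: gZ].
  have [m [u uE]] := noetherian_submodule noethR subfg (@subIsetr _ _ _).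
  have /choice[v vP] : forall i, exists y, f y = u i.
    move=> i; have [[y _ fy] _] : (range f `&` lspan g) (u i).
      by rewrite uE; apply: mem_lspan.
    by exists y.
  apply/PhiP; exists m, v => p Sp Wp x; have [r pr rx] := gP p Sp Wp (f x).
  exists r => //; have [c xE] : lspan u (f (r *: x)).
    by rewrite -uE; split; [exists (r *: x) | rewrite linearZ].
  exists c; apply: injf; rewrite xE linear_sum.
  by apply: eq_bigr => i _; rewrite linearZ vP.
- move=> A B C f h [injf fh surjh] /PhiP[n [a aP]] /PhiP[m [c cP]].
  have /choice[b bP] := fun i => surjh (c i).
  have [k [u [ua ub _]]] := lspan_union (f \o a) b.
  have [u0 uD uZ] := is_submodule_lspan u.
  apply/PhiP; exists k, u => p Sp Wp x.
  have [r pr [d rx]] := cP p Sp Wp (h x).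
  pose w := \sum_(i < m) d i *: b i.
  have uw : lspan u w by apply: (lspan_sub (is_submodule_lspan u) ub); exists d.
  have [y _ fy] : range f (r *: x - w).
    rewrite fh /= linearB linearZ /= rx /w linear_sum.
    by rewrite -sumrB big1 // => i _; rewrite linearZ /= bP subrr.
  have [s ps sy] := aP p Sp Wp y; exists (s * r); first exact: prime_notM.
  rewrite -scalerA -[r *: x](subrK w) -fy scalerDr.
  apply: uD (uZ _ _ uw); rewrite -linearZ.
  exact/(lspan_sub (is_submodule_lspan u) ua)/linear_lspan.
Qed.

End Support.

(** * Recovering [W] from [Phi W] *)

Section Injectivity.
Variable R : comPzRingType.

(* Test on the direct sum of countably many copies of R/p: a finitely generated
   submodule meets only finitely many of them. *)
Lemma Phi_subset (W1 W2 : set (set R)) : specialization_closed W1 ->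
  (forall M : lmodType R, Phi W1 M -> Phi W2 M) -> W1 `<=` W2.
Proof.
move=> [W1S W1c] W12 p W1p; have Sp := W1S _ W1p.
have [p0 pD pM] := prime_ideal Sp.
(* Sequences eventually in [p], modulo sequences in [p]: the quotient is a countable direct sum of
   copies of [R/p]. *)
pose N : set (nat -> R^o) := [set f | exists n, forall k, (n <= k)%N -> p (f k)].
pose N0 : set (nat -> R^o) := [set f | forall k, p (f k)].
have subN : is_submodule N.
  split.
  - by exists 0%N.
  - move=> f g [m fm] [n gn]; exists (maxn m n) => k; rewrite geq_max => /andP[mk nk].
    by apply: pD; [apply: fm | apply: gn].
  - by move=> a f [m fm]; exists m => k mk; apply/pM/fm.
have subN0 : is_submodule N0.
  split=> [k|f g fp gp k|a f fp k]; [exact: p0|exact: pD|exact/pM].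
have [A [Q [f [h [injf fA surjh hQ]]]]] := exists_subquotient subN subN0.
have /W12/PhiP[n [g gP]] : Phi W1 Q.
  apply/Phi_supported_in/supported_inP => q Sq W1q x.
  have /existsNP[r /not_implyP[pr qr]] : ~ p `<=` q.
    by move=> pq; apply/W1q/(W1c p).
  exists r => //; have [a <-] := surjh x; rewrite -linearZ; apply/hQ => k.
  by rewrite linearZ; have := pM (f a k) r pr; rewrite mulrC.
apply: contrapT => W2p.
have /choice[a aP] := fun i => surjh (g i).
have /choice[b bP] : forall i, exists m, forall k, (m <= k)%N -> p (f (a i) k).
  by move=> i; have : N (f (a i)) by rewrite -fA; exists (a i).
(* From index [m] on, all generators have coordinates in [p]. A multiple [r] of the unit vector at
   [m] that lies in their span therefore has [r] in [p]. *)
pose m := \max_(i < n) b i.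
have [e _ eE] : range f (fun k => (k == m)%:R).
  by rewrite fA; exists m.+1 => k; case: ltngtP => // _ _; exact: p0.
have [r pr [c re]] := gP p Sp W2p (h e); apply: pr.
have /hQ/(_ m) : h (r *: e - \sum_(i < n) c i *: a i) = 0.
  rewrite linearB linearZ /= re linear_sum -sumrB big1 // => i _.
  by rewrite linearZ /= aP subrr.
have cm : p (f (\sum_(i < n) c i *: a i) m).
  rewrite linear_sum; elim/big_rec: _ => [|i u _ pu]; first exact: p0.
  apply: pD => //; rewrite linearZ; apply/pM/bP.
  exact: (@leq_bigmax_cond _ _ b).
rewrite linearB linearZ /= eE => /pD/(_ cm); set w := f _ m in cm *.
by rewrite -[_ + w]/(r * (m == m)%:R - w + w) subrK eqxx mulr1.
Qed.

End Injectivity.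

(** * Serre subcategories closed under direct sums *)

Section Surjectivity.
Variables (R : comPzRingType) (S : subcat R).
Hypotheses (noethR : noetherian R) (serreS : serre S).

(** Expresses that [R/I] lies in [S], up to isomorphism, through a presentation with kernel [I]. *)
Let has_cyclic (I : set R) := exists (M : lmodType R) (h : {linear R^o -> M}),
  [/\ surjective_map h, forall r, h r = 0 <-> I r & S M].

Lemma has_cyclic_quotient (I : set R) (M : lmodType R) (h : {linear R^o -> M}) :
  has_cyclic I -> surjective_map h -> (forall r, I r -> h r = 0) -> S M.
Proof.
move=> [N [g [surjg gI SN]]] surjh hI.
have [|k kE] := linear_factor surjg (g := h) _; first by move=> r /gI/hI.
case: serreS => _ _ _ quo _; apply: (quo _ _ k) => // y.
by have [r <-] := surjh y; exists (g r).
Qed.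

Lemma has_cyclic_mono (I J : set R) :
  has_cyclic I -> is_ideal J -> I `<=` J -> has_cyclic J.
Proof.
move=> cI idJ IJ; have [Q [h [surjh hQ]]] := @exists_quotient R R^o J idJ.
exists Q, h; split=> //; apply: (has_cyclic_quotient cI) => // r /IJ.
by move/hQ.
Qed.

(** [R/I] embeds in [M] as the cyclic submodule [Rx]. *)
Lemma has_cyclic_ann (M : lmodType R) (x : M) (I : set R) :
  S M -> (forall r, r *: x = 0 <-> I r) -> is_ideal I -> has_cyclic I.
Proof.
move=> SM xI idI; have [Q [h [surjh hQ]]] := @exists_quotient R R^o I idI.
exists Q, h; split=> //; have [g gE] := exists_scale x.
have [|k kE] := linear_factor surjh (g := g) _.
  by move=> r /hQ; rewrite gE => /xI.
case: serreS => _ _ sub _ _; apply: (sub _ _ k) SM => u v.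
have [r <-] := surjh u; have [s <-] := surjh v.
rewrite !kE !gE => /eqP; rewrite -subr_eq0 -scalerBl => /eqP/xI/hQ.
by rewrite linearB => /subr0_eq.
Qed.

Let W := [set p | Spec R p /\ has_cyclic p].

Lemma cyclic_primes_specialization_closed : specialization_closed W.
Proof.
split=> [p []//|p q [Sp cp] Sq pq]; split=> //.
by apply: has_cyclic_mono pq => //; apply: prime_ideal.
Qed.

Lemma is_ideal_ann (M : lmodType R) (x : M) : is_ideal [set r : R | r *: x = 0].
Proof.
split=> [|a b /= xa xb|a b /= xb]; first exact: scale0r.
- by rewrite scalerDl xa xb addr0.
- by rewrite -scalerA xb scaler0.
Qed.

Lemma serre_supported_in M : S M -> supported_in W M.
Proof.
move=> SM p /SuppP[Sp [x xp]]; split=> //.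
apply: has_cyclic_mono (prime_ideal Sp) xp.
exact: (has_cyclic_ann SM (fun=> iff_refl _) (is_ideal_ann x)).
Qed.

(** The step of [ideal_ind] is the exact sequence [0 -> R/(I : a) -> R/I -> R/(I + Ra) -> 0], whose
    first map is multiplication by [a]. *)
Lemma has_cyclic_of_primes (I : set R) : is_ideal I ->
  (forall p, Spec R p -> I `<=` p -> has_cyclic p) -> has_cyclic I.
Proof.
case: serreS => [[M0 SM0] _ sub _ ext].
move: I; apply: (ideal_ind noethR) => [_|p Sp|I a idI IHadj IHcol Ip].
(* The quotient by the unit ideal is zero and embeds in any module [M0] of [S]. *)
- have idT : is_ideal [set: R] by [].
  have [Q [h [surjh hQ]]] := @exists_quotient R R^o _ idT.
  exists Q, h; split=> //; have [z zE] := @exists_linear _ Q M0 (fun=> 0)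
    (fun _ _ _ => esym (etrans (addr0 _) (scaler0 _ _))).
  apply: (sub _ _ z) SM0 => u v _; have [r <-] := surjh u; have [s <-] := surjh v.
  by transitivity (0 : Q); [apply/hQ | apply/esym/hQ].
- by apply.
have {IHadj} [B [b [surjb bI SB]]] : has_cyclic (adjoin I a).
  by apply: IHadj => p Sp Ap; apply: Ip => //; apply: subset_trans Ap; apply: sub_adjoin.
have {IHcol} [C [c [surjc cI SC]]] : has_cyclic (colon I a).
  apply: IHcol => p Sp Cp; apply: Ip => //; apply: subset_trans Cp.
  exact: sub_colon.
have [Q [q [surjq qI]]] := @exists_quotient R R^o _ idI.
have qM r s : q (r * s) = r *: q s by rewrite -linearZ.
have [g gE] := exists_scale (q a).
have [|i iE] := linear_factor surjc (g := g) _.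
  by move=> r /cI Ira; rewrite gE -qM; apply/qI.
have [|j jE] := linear_factor surjq (g := b) _.
  by move=> r /qI Ir; apply/bI/sub_adjoin.
exists Q, q; split=> //; apply: (ext _ _ _ i j) SC SB; split.
- move=> u v; have [r <-] := surjc u; have [s <-] := surjc v.
  rewrite !iE !gE => /eqP; rewrite -subr_eq0 -scalerBl -qM => /eqP/qI/cI.
  by rewrite linearB => /subr0_eq.
- apply/seteqP; split=> [_ [u _ <-]|y].
    have [r <-] := surjc u; rewrite iE gE -qM /preimage /= jE.
    by apply/bI; exists 0, r; rewrite add0r; split=> //; case: idI.
  have [r <-] := surjq y; rewrite /preimage /= jE => /bI[s [t [Is rE]]].
  exists (c t) => //; rewrite iE gE -qM rE linearD.
  by move/qI: Is => ->; rewrite add0r.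
- by move=> v; have [r <-] := surjb v; exists (q r).
Qed.

(** * Every module as a quotient of the direct sum of its cyclic submodules *)

Section DirectSum.
Variable M : lmodType R.

Definition cyclic (x : M) : set M := [set y | exists r, y = r *: x].

Lemma is_submodule_cyclic x : is_submodule (cyclic x).
Proof.
split=> [|_ _ [r ->] [s ->]|a _ [r ->]].
- by exists 0; rewrite scale0r.
- by exists (r + s); rewrite scalerDl.
- by exists (a * r); rewrite scalerA.
Qed.

Definition cyclic_type x : lmodType R :=
  submodule_type (Submodule (is_submodule_cyclic x)).

(** The direct sum of the [Rx] over all [x] in [M], encoded inside the functions [M -> M] so that
    its elements are not dependent families. *)
Definition cyclic_families : set (M -> M) :=
  [set f | (forall x, cyclic x (f x)) /\ finite_set [set x | f x <> 0]].

Lemma is_submodule_cyclic_families : is_submodule cyclic_families.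
Proof.
split.
- split=> [x|]; first by case: (is_submodule_cyclic x).
  by rewrite [X in finite_set X](_ : _ = set0) // -subset0 => x; apply.
- move=> f g [fc ff] [gc gf]; split=> [x|].
    by case: (is_submodule_cyclic x) => _ + _; apply.
  apply: (sub_finite_set _ (_ : finite_set ([set x | f x <> 0] `|` [set x | g x <> 0]))).
    move=> x; apply: contra_notP => /not_orP[] /contrapT fx /contrapT gx.
    by rewrite addrfctE fx gx addr0.
  by rewrite finite_setU.
- move=> a f [fc ff]; split=> [x|].
    by case: (is_submodule_cyclic x) => _ _; apply.
  apply: sub_finite_set ff => x; apply: contra_not => fx.
  by rewrite scalrfctE fx scaler0.
Qed.

Definition cyclic_sum : lmodType R :=
  submodule_type (Submodule is_submodule_cyclic_families).

Lemma cyclic_sumP (f : cyclic_sum) : cyclic_families (\val f).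
Proof. exact: (submodule_valP f). Qed.

Lemma cyclic_sum_valP a (f g : cyclic_sum) x :
  \val (a *: f + g) x = a *: \val f x + \val g x.
Proof.
exact: (congr1 (@^~ x) (linearP (\val : {linear cyclic_sum -> (M -> M)}) a f g)).
Qed.

Lemma is_direct_sum_cyclic_sum : is_direct_sum cyclic_type cyclic_sum.
Proof.
have Hpi : forall x, exists h : {linear cyclic_sum -> cyclic_type x},
    forall f, \val (h f) = \val f x.
  move=> x; have fx f := (cyclic_sumP f).1 x.
  have [|h hE] := @exists_linear _ cyclic_sum (cyclic_type x)
    (fun f => @submodule_elt _ _ (Submodule (is_submodule_cyclic x)) _ (fx f)).
    move=> a f g; apply: val_inj; rewrite [RHS]linearP.
    exact: cyclic_sum_valP.
  by exists h => f; rewrite hE.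
pose pi x := projT1 (cid (Hpi x)).
have piE x f : \val (pi x f) = \val f x by rewrite /pi; case: cid.
exists pi; split.
  move=> f; have [_] := cyclic_sumP f; apply: sub_finite_set => x.
  by apply: contra_not => fx0; apply: val_inj; rewrite piE fx0 linear0.
move=> f ff; have fF : cyclic_families (fun x => \val (f x)).
  split=> [x|]; first exact: (submodule_valP (f x)).
  by apply: sub_finite_set ff => x; apply: contra_not => ->; rewrite linear0.
exists (@submodule_elt _ _ (Submodule is_submodule_cyclic_families) _ fF).
split=> [x|g gE]; first by apply: val_inj; rewrite piE.
by apply: val_inj; apply/funext => x /=; rewrite -gE piE.
Qed.

(** The map adds up the components; [y] is the image of the family with the single component [y] at
    index [y]. For linearity, all sums are taken over the union of two finite supports. *)
Lemma cyclic_sum_surjective :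
  exists h : {linear cyclic_sum -> M}, surjective_map h.
Proof.
pose s (f : cyclic_sum) : M := \sum_(x \in [set: M]) \val f x.
have sE (A : {fset M}) f : [set x | \val f x <> 0] `<=` [set` A] ->
    s f = \sum_(x <- A) \val f x.
  move=> fA; apply: fsbigTE => x; apply: contraNeq => /eqP fx0; exact: fA.
have [|h hE] := @exists_linear _ cyclic_sum M s.
  move=> a f g; have [_ /finite_fsetP[A fA]] := cyclic_sumP f.
  have [_ /finite_fsetP[B gB]] := cyclic_sumP g.
  have fAB x : x \notin (A `|` B)%fset -> \val f x = 0 /\ \val g x = 0.
    rewrite in_fsetU negb_or => /andP[xA xB]; split; apply: contrapT.
      by move=> fx0; move/negP: xA; apply; have : [set` A] x by rewrite -fA.
    by move=> fx0; move/negP: xB; apply; have : [set` B] x by rewrite -gB.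
  have sAB u : (forall x, \val f x = 0 -> \val g x = 0 -> \val u x = 0) ->
      s u = \sum_(x <- (A `|` B)%fset) \val u x.
    move=> fgu; apply: sE => x; apply: contra_notP => /negP /fAB[].
    exact: fgu.
  rewrite !sAB //; last first.
    move=> x f0 g0; apply: (etrans (cyclic_sum_valP a f g x)).
    by rewrite f0 g0 scaler0 addr0.
  rewrite scaler_sumr -big_split /=; apply: eq_bigr => x _.
  exact: cyclic_sum_valP.
exists h => y.
have fF : cyclic_families (fun x => if x == y then y else 0).
  split=> [x|].
    case: eqP => [->|_]; first by exists 1; rewrite scale1r.
    by case: (is_submodule_cyclic x).
  by apply: (sub_finite_set _ (finite_set1 y)) => x /=; case: eqP.
exists (@submodule_elt _ _ (Submodule is_submodule_cyclic_families) _ fF).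
rewrite hE (sE [fset y]%fset) ?big_seq_fset1 /= ?eqxx // => x /=.
by rewrite in_fset1; case: eqP.
Qed.

End DirectSum.

(** Each [Rx] is [R/I] for the annihilator [I] of [x], and the primes above [I] lie in the support
    of [M], hence in [W]. *)
Lemma supported_in_serre_direct_sum M :
  direct_sum_closed S -> supported_in W M -> S M.
Proof.
move=> dsS MW; case: (serreS) => _ _ _ quo _.
have [h surjh] := cyclic_sum_surjective M.
apply: (quo _ _ h surjh); apply: dsS (@is_direct_sum_cyclic_sum M) _ => x.
have cx : has_cyclic [set r : R | r *: x = 0].
  apply: has_cyclic_of_primes (is_ideal_ann x) _ => p Sp xp.
  by have [] : W p by apply: MW; apply/SuppP; split=> //; exists x.
have xx : cyclic x x by exists 1; rewrite scale1r.
pose y : cyclic_type x := @submodule_elt _ _ (Submodule (is_submodule_cyclic x)) _ xx.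
have [g gE] := exists_scale y.
apply: (has_cyclic_quotient cx (h := g)) => [z|r /= rx].
  have [r zE] := submodule_valP z; exists r; rewrite gE.
  by apply: val_inj; rewrite linearZ.
by rewrite gE; apply: val_inj; rewrite linearZ /= rx.
Qed.

End Surjectivity.

Lemma serre_direct_sum_supported_in (R : comPzRingType) (S : subcat R) :
    noetherian R -> serre S -> direct_sum_closed S ->
  exists2 W, specialization_closed W & S = supported_in W.
Proof.
move=> noethR serreS dsS; eexists.
  exact: (cyclic_primes_specialization_closed serreS).
apply: funext => M; apply: propext; split; first exact: serre_supported_in.
exact: supported_in_serre_direct_sum.
Qed.

(** * The Melkersson condition *)

(* An element y of the localization D_x of the domain D = R/J is encoded by the
   sequence of the x^k y, which lie in D for k large; it belongs to D if and
   only if x^k y lies in x^k D for k large. *)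
Section Fractions.
Variables (R : comPzRingType) (J q : set R) (x : R).
Hypotheses (SJ : Spec R J) (Jx : ~ J x).

Definition integral_seq : set (nat -> R^o) :=
  [set f : nat -> R^o | exists n, forall k, (n <= k)%N -> adjoin J (x ^+ k) (f k)].

(** The first condition says that [f] encodes an element of [D_x]; the second, that some power of
    [q] carries this element into [D]. *)
Definition torsion_seq : set (nat -> R^o) :=
  [set f : nat -> R^o | (exists n, forall k, (n <= k)%N -> J (f k.+1 - x * f k)) /\
    exists n, forall l : seq R, size l = n -> (forall a, a \in l -> q a) ->
      integral_seq ((\prod_(a <- l) a) *: f)].

(* the fraction c / x^m; the truncated values at k < m are irrelevant *)
Definition frac (c : R) (m : nat) : nat -> R^o := fun k => c * x ^+ (k - m).

Let idJ : is_ideal J := prime_ideal SJ.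

(** Cancels [x ^+ k], which is nonzero in the domain [R/J]. *)
Lemma adjoin_exp c m k :
  adjoin J (x ^+ (m + k)) (c * x ^+ k) <-> adjoin J (x ^+ m) c.
Proof.
have [_ JD JM] := idJ; rewrite exprD; split=> [[j [d [Jj]]]|[j [d [Jj ->]]]].
  rewrite mulrA => /eqP; rewrite -subr_eq -mulrBl => /eqP E.
  exists (c - d * x ^+ m), d; split; last by rewrite subrK.
  case: (SJ) => _ _ JP; have [|//|/(prime_exp SJ)//] := JP (c - d * x ^+ m) (x ^+ k).
  by rewrite E.
exists (x ^+ k * j), d; split; first exact: JM.
by rewrite mulrDl mulrA (mulrC j).
Qed.

Lemma is_submodule_integral_seq : is_submodule integral_seq.
Proof.
have idA k := is_ideal_adjoin (x ^+ k) idJ.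
split.
- by exists 0%N => k _; case: (idA k).
- move=> f g [m fm] [n gn]; exists (maxn m n) => k; rewrite geq_max => /andP[mk nk].
  by case: (idA k) => _ + _; apply; [apply: fm | apply: gn].
- by move=> a f [m fm]; exists m => k mk; case: (idA k) => _ _; apply; apply: fm.
Qed.

Lemma is_submodule_torsion_seq : is_submodule torsion_seq.
Proof.
have [J0 JD JM] := idJ; have [s0 sD sZ] := is_submodule_integral_seq.
split.
- split; exists 0%N.
    by move=> k _; rewrite [X in J X](_ : _ = 0) // -[LHS]/(0 - x * 0) mulr0 subr0.
  by move=> l _ _; rewrite scaler0.
- move=> f g [[m fm] [m' fm']] [[n gn] [n' gn']]; split.
    exists (maxn m n) => k; rewrite geq_max => /andP[mk nk].
    rewrite -[_ - _]/(f k.+1 + g k.+1 - x * (f k + g k)) mulrDr opprD addrACA.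
    by apply: JD; [apply: fm | apply: gn].
  (* The first [m'] factors make [f] integral, the remaining [n'] make [g] integral. *)
  exists (m' + n')%N => l sl ql; rewrite -[l](cat_take_drop m') big_cat /= scalerDr.
  apply: sD; [rewrite mulrC|]; rewrite -scalerA; apply: sZ.
    apply: fm' => [|b /mem_take/ql //]; rewrite size_takel // sl.
    exact: leq_addr.
  by apply: gn' => [|b /mem_drop/ql //]; rewrite size_drop sl addKn.
- move=> a f [[m fm] [m' fm']]; split.
    exists m => k mk; rewrite -[_ - _]/(a * f k.+1 - x * (a * f k)) mulrCA -mulrBr.
    exact/JM/fm.
  by exists m' => l sl ql; rewrite scalerA mulrC -scalerA; apply/sZ/fm'.
Qed.

Lemma scale_frac a c m : a *: frac c m = frac (a * c) m.
Proof. by apply/funext => k; rewrite /frac -[LHS]/(a * (c * _)) mulrA. Qed.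

(** By [adjoin_exp], the test at index [m + k] does not depend on [k]. *)
Lemma integral_frac c m : integral_seq (frac c m) <-> adjoin J (x ^+ m) c.
Proof.
split=> [[n /(_ (m + n)%N (leq_addl _ _))]|cm].
  by rewrite /frac addKn => /adjoin_exp.
by exists m => k mk; rewrite /frac -{1}(subnKC mk); apply/adjoin_exp.
Qed.

Lemma torsion_frac c m n :
    (forall l : seq R, size l = n -> (forall a, a \in l -> q a) ->
      adjoin J (x ^+ m) (\prod_(a <- l) a * c)) ->
  torsion_seq (frac c m).
Proof.
move=> cn; split.
  exists m => k mk; rewrite /frac subSn // exprS mulrCA subrr.
  by case: idJ.
by exists n => l sl ql; rewrite scale_frac; apply/integral_frac/cn.
Qed.

(** If [x] carries an element of [D_x] into [D], that element has the form [c / x]. Cancelling [x]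
    shows this at one index, and the recurrence of [f] propagates it. *)
Lemma integral_scale_frac f : torsion_seq f -> integral_seq (x *: f) ->
  exists c n, forall k, (n <= k)%N -> J ((f - frac c 1) k).
Proof.
have [_ JD JM] := idJ; move=> [[m fm] _] [n xn].
(* Large enough for both the recurrence and integrality, and positive so that one factor [x] can be
   cancelled. *)
pose k0 := (m + n).+1.
have [j [c [Jj E]]] := xn k0 (leqW (leq_addl m n)).
have Jk0 : J (f k0 - c * x ^+ (k0 - 1)).
  have [_ _ JP] := SJ; have [|//|//] := JP x (f k0 - c * x ^+ (k0 - 1)).
  rewrite mulrBr mulrCA -exprS subn1 -[x * f k0]/((x *: f) k0) E.
  by rewrite [in c * x ^+ k0]/k0 addrK.
exists c, k0; elim=> [//|k IHk]; rewrite leq_eqVlt => /orP[/eqP <-//|].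
rewrite ltnS => k0k; have k_gt0 : (0 < k)%N by apply: leq_trans k0k.
rewrite -[X in J X]/(f k.+1 - c * x ^+ (k.+1 - 1)).
rewrite -[_ - _](subrKA (x * f k)); apply: JD.
  by apply: fm; apply: leq_trans k0k; apply/leqW/leq_addr.
by rewrite subSn // exprS mulrCA -mulrBr; apply/JM/IHk.
Qed.

End Fractions.

(** * Failure of the Melkersson condition at non-minimal primes outside [W] *)

Section Melkersson.
Variable R : comPzRingType.
Hypothesis noethR : noetherian R.

Lemma melkersson_Phi (W : set (set R)) (q : set R) :
  Spec R q -> ~ minimal_prime q -> melkersson (Phi W) q -> W q.
Proof.
move=> Sq minq melk; apply: contrapT => Wq.
have [p [Sp pq pNq]] : exists p, [/\ Spec R p, p `<=` q & p <> q].
  apply: contrapT => nop; apply: minq; split=> // p Sp pq.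
  by apply: contrapT => pNq; apply: nop; exists p.
have [J [SJ Jq JNq] Jmax] := @noetherian_max _ noethR
  [set J | [/\ Spec R J, J `<=` q & J <> q]] p
  (fun J '(And3 SJ _ _) => prime_ideal SJ) (And3 Sp pq pNq).
have [x [qx Jx]] : exists x, q x /\ ~ J x.
  apply: contrapT => nox; apply: JNq; rewrite eqEsubset; split=> // x qx.
  by apply: contrapT => Jx; apply: nox; exists x.
have idJ := prime_ideal SJ.
have [q0 qD qM] := prime_ideal Sq.
have subI := is_submodule_integral_seq x SJ.
have [A [Q [f [h [injf fA surjh hQ]]]]] :=
  exists_subquotient (is_submodule_torsion_seq q x SJ) subI.
have fT a : torsion_seq J q x (f a) by rewrite -fA; exists a.
have [I0 ID IZ] := subI.
have idtors a : is_ideal [set r | integral_seq J x (r *: f a)].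
  split=> [|r s /= fr fs|r s /= fs]; first by rewrite /= scale0r.
    by rewrite scalerDl; apply: ID.
  by rewrite -scalerA; apply: IZ.
have GQ : Gamma q Q = setT.
  rewrite eqEsubset; split=> // u _; have [a <-] := surjh u.
  (* [Gamma] asks for a positive exponent and [n] may be 0, so one spare factor is added. *)
  have [_ [n an]] := fT a; exists n.+1; split=> // r qr.
  rewrite -linearZ; apply/hQ; rewrite linearZ -[r]mul1r.
  apply: (ideal_exp_ind (idtors a) (I := q) (n := n.+1)) qr => -[//|b l] [sl] ql.
  rewrite mul1r big_cons /= -scalerA; apply: IZ.
  by apply: an => // c cl; apply: ql; rewrite inE cl orbT.
have fgann : fg_module (ann q Q).
  (* As [x] lies in [q], a class in [D_x/D] killed by [q] is that of some [d / x]. The possible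
     numerators form the ideal [L], whose generators give generators of the submodule killed by
     [q]. *)
  pose L := [set d | forall a, q a -> adjoin J x (a * d)].
  have idL : is_ideal L.
    have [a0 aD aM] := is_ideal_adjoin x idJ.
    split=> [a _|d e Ld Le a qa|d e Le a qa]; first by rewrite mulr0.
      by rewrite mulrDr; apply: aD; [apply: Ld | apply: Le].
    by rewrite mulrCA; apply/aM/Le.
  have [m [d LE]] := noethR idL.
  have dL i : L (d i) by apply: mem_generator LE.
  have /choice[w wE] : forall i, exists a, f a = frac x (d i) 1.
    move=> i; have : range f (frac x (d i) 1); last by case=> a _; exists a.
    rewrite fA; apply: (@torsion_frac _ _ _ _ SJ Jx _ _ 1) => -[//|a [|//]] _ qa.
    by rewrite big_seq1; apply: dL; apply: qa; rewrite inE.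
  have wann i : h (w i) \in @ann_pred R q Q.
    apply/asboolP => a qa; rewrite -linearZ; apply/hQ; rewrite linearZ /= wE.
    by rewrite scale_frac; apply/(integral_frac SJ Jx)/dL.
  exists m, (fun i => Ann (wann i)) => v; have [b bE] := surjh (\val v).
  have vann a : q a -> integral_seq J x (a *: f b).
    move=> qa; rewrite -linearZ; apply/hQ; rewrite linearZ /= bE.
    by case: (v) => u /= /asboolP; apply.
  have [c [n cn]] := integral_scale_frac SJ Jx (fT b) (vann x qx).
  have fbc : integral_seq J x (f b - frac x c 1).
    by exists n => k nk; apply/sub_adjoin/cn.
  (* For [a] in [q], [a * c / x] differs from the integral [a *: f b] by a multiple of an integral
     sequence. *)
  have : L c.
    move=> a qa; rewrite -[x]expr1; apply/(integral_frac SJ Jx).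
    rewrite -scale_frac -[_ *: _](subKr (a *: f b)) -scalerBr.
    by apply: submoduleB => //; [apply: vann | apply: IZ].
  rewrite LE => -[e cE]; exists e; apply: val_inj; rewrite linear_sum /= -bE.
  apply/subr0_eq.
  have -> : \sum_(i < m) \val (e i *: Ann (wann i)) = h (\sum_(i < m) e i *: w i).
    by rewrite linear_sum; apply: eq_bigr => i _; rewrite !linearZ.
  rewrite -linearB; apply/hQ; rewrite linearB.
  have -> : f (\sum_(i < m) e i *: w i) = frac x c 1; last by [].
  rewrite linear_sum; under eq_bigr => i _ do rewrite linearZ /= wE scale_frac.
  apply/funext => k; rewrite /frac cE mulr_suml.
  by elim/big_ind2: _ => // u r v' s <- <-.
have /PhiP[n [g gP]] := melk Q GQ (Phi_fg W fgann).
(* Powers of [x] are products of elements of [q], so the torsion exponent of a generator yields a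
   power of [x] killing it. *)
have /choice[b bP] : forall i, exists k, x ^+ k *: g i = 0.
  move=> i; have [a <-] := surjh (g i); have [_ [k kP]] := fT a; exists k.
  rewrite -linearZ; apply/hQ; rewrite linearZ.
  have := kP (nseq k x); rewrite size_nseq big_nseq -Monoid.iteropE; apply=> // y.
  by rewrite mem_nseq => /andP[_ /eqP ->].
pose N := (\max_(i < n) b i)%N.
have xN (u : Q) : lspan g u -> x ^+ N *: u = 0.
  move=> [c ->]; rewrite scaler_sumr big1 // => i _.
  rewrite scalerA mulrC -scalerA -(@subnK (b i) N) ?exprD.
    by rewrite -scalerA bP !scaler0.
  exact: (@leq_bigmax_cond _ _ b).
(* A prime inside [q] that contains [J] and a power of [x] contains [x], so it is not [J]; by
   maximality of [J] it is [q]. *)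
have xmin p' : Spec R p' -> adjoin J (x ^+ N.+1) `<=` p' -> p' `<=` q -> p' = q.
  move=> Sp' Jp' p'q; apply: contrapT => p'Nq.
  have E := Jmax p' (And3 Sp' p'q p'Nq) (subset_trans (@sub_adjoin _ _ _) Jp').
  by apply: Jx; rewrite -E; apply/(prime_exp Sp')/Jp'/mem_adjoin.
have [k [s [qs sP]]] :=
  minimal_over_nilpotent noethR Sq (is_ideal_adjoin _ idJ) xmin.
(* Products of [k] elements of [q] multiply [s] into [J + x^(N+1) R], so [s / x^(N+1)] is torsion
   modulo [D]. *)
have [w _ wE] : range f (frac x s N.+1).
  rewrite fA; apply: (@torsion_frac _ _ _ _ SJ Jx _ _ k) => l sl ql.
  by rewrite mulrC; apply: sP.
(* [r * s / x^(N+1)] falls in the span, so [x ^+ N] kills it modulo [D]. The exponent [N+1] leaves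
   one [x]: [r * s] lies in [J + xR], inside [q], while neither [r] nor [s] is in [q]. *)
have [r qr /xN] := gP q Sq Wq (h w).
rewrite scalerA -linearZ => /hQ; rewrite linearZ /= wE scale_frac.
move=> /(integral_frac SJ Jx); rewrite -add1n -mulrA mulrC.
move=> /(adjoin_exp SJ Jx); rewrite expr1 => -[j [c [Jj E]]].
apply: (prime_notM Sq qr qs); rewrite E; apply: qD; first exact: Jq.
exact: qM.
Qed.

End Melkersson.

(** * [Phi] and [Psi] as inverse maps *)

Section Correspondence.
Variable R : comPzRingType.
Implicit Types (W : set (set R)) (p q : set R).

(** A prime [p] outside [W] cannot contain [q], and powers of an element of [q] outside [p] kill a
    [q]-torsion module elementwise. *)
Lemma Phi_melkersson W q :
  specialization_closed W -> W q -> melkersson (Phi W) q.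
Proof.
move=> [WS Wc] Wq M GM _; apply/Phi_supported_in/supported_inP => p Sp Wp x.
have /existsNP[r /not_implyP[qr pr]] : ~ q `<=` p by move=> qp; apply/Wp/(Wc q).
have [n [_ nx]] : Gamma q M x by rewrite GM.
by exists (r ^+ n) => [/(prime_exp Sp)//|]; apply/nx/ideal_exp_expr.
Qed.

Lemma Phi_inj W1 W2 : specialization_closed W1 -> specialization_closed W2 ->
  Phi W1 = Phi W2 -> W1 = W2.
Proof.
move=> c1 c2 E; rewrite eqEsubset; split; apply: Phi_subset => // M;
  by rewrite E.
Qed.

(** Every prime other than [p] is non-minimal, as [melkersson_Phi] requires; [Psi] removes [p],
    which is not in [W]. *)
Lemma Psi_Phi W p : noetherian R -> specialization_closed W ->
  unique_minimal_prime p -> ~ W p -> Psi p (Phi W) = W.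
Proof.
move=> noethR Wc [_ pu] Wp; rewrite eqEsubset; split=> q.
  move=> [[Sq melk] /= qNp]; apply: melkersson_Phi melk => //.
  by move=> /pu/qNp.
move=> Wq; split; last by move=> /= E; apply: Wp; rewrite -E.
by split; [exact: Wc.1 | exact: Phi_melkersson].
Qed.

(** Every prime contains [p], so [p] in [W] would force [W] to be the whole spectrum. *)
Lemma proper_specialization_closed_minimal W p : unique_minimal_prime p ->
  proper_specialization_closed W -> ~ W p.
Proof.
move=> pu [[WS Wc] WNS] Wp; apply: WNS; rewrite eqEsubset; split=> // q Sq.
exact: (Wc p q Wp Sq (unique_minimal_prime_sub pu Sq)).
Qed.

Lemma supported_in_Spec : supported_in (Spec R) = @all_modules R.
Proof.
by apply: funext => M; apply: propext; split=> [_|_ p /SuppP[]//]; exact: I.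
Qed.

(** Test on [R] itself: the annihilator of 1 is zero, so every prime is in the support. *)
Lemma supported_in_all_modules W : supported_in W = @all_modules R -> Spec R `<=` W.
Proof.
move=> E p Sp; have : supported_in W R^o by rewrite E.
apply; apply/SuppP; split=> //; exists 1 => r.
by rewrite -[_ *: _]/(r * 1) mulr1 => ->; case: (prime_ideal Sp).
Qed.

End Correspondence.

Theorem mainTheorem6 (R : comPzRingType) (noethR : noetherian R) :
  (bij_on (@specialization_closed R) (@fg_star R) (@Phi R) /\
   maps_to (@specialization_closed R) (@serre_containing_fg R) (@Phi R) /\
   inj_on (@specialization_closed R) (@Phi R)) /\
  (forall p : set R, unique_minimal_prime p ->
     mutually_inverse (@proper_specialization_closed R) (@proper_fg_star R)
       (@Phi R) (Psi p)).
Proof.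
have Phi_fg_star (W : set (set R)) : fg_star (Phi W).
  exists (supported_in W); split=> //; first exact: supported_in_serre.
  exact: supported_in_direct_sum_closed.
split; [split; [|split]|].
- split=> [W _|W1 W2|S [M [serreM dsM ->]]]; first exact: Phi_fg_star.
    exact: Phi_inj.
  by have [W Wc ->] := serre_direct_sum_supported_in noethR serreM dsM; exists W.
- move=> W _; split; first exact: Phi_serre.
  exact: Phi_fg.
- exact: Phi_inj.
move=> p pu.
have PsiK W : proper_specialization_closed W -> Psi p (Phi W) = W.
  move=> Wc; apply: Psi_Phi => //; first exact: Wc.1.
  exact: proper_specialization_closed_minimal Wc.
(* Once every target is some [Phi W], both clauses about [Psi S] follow from [PsiK]. *)
have surj (S : subcat R) : proper_fg_star S ->
    exists2 W, proper_specialization_closed W & S = Phi W.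
  move=> [M [serreM dsM MN ->]].
  have [W Wc E] := serre_direct_sum_supported_in noethR serreM dsM.
  exists W; last by rewrite E.
  by split=> // WS; apply: MN; rewrite E WS supported_in_Spec.
split=> // [W Wc|S /surj[W Wc ->]|S /surj[W Wc ->]]; last by rewrite PsiK.
- exists (supported_in W); split=> //; first exact: supported_in_serre.
    exact: supported_in_direct_sum_closed.
  move/supported_in_all_modules => SW; apply: Wc.2; rewrite eqEsubset.
  by split=> //; case: Wc => -[].
- by rewrite PsiK.
Qed.
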